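(* Let $p$ be a prime, $m,n\ge 2$ integers and $a,b,c,d,e,f,g,h\in\mathbb{Z}_p$. Let $T_{\mathrm R}^{\phi_{270^\circ}}\in \mathbf{M}_{mn\times mn}(\mathbb{Z}_p)$ be the rule matrix of the finite two-dimensional linear Moore cellular automaton on an $m\times n$ grid with coefficients $a,\dots,h$ under the mixed boundary condition $\phi_{270^\circ}$ (null on the bottom and left, reflexive on the top and right). Then $T_{\mathrm R}^{\phi_{270^\circ}}$ is the $m\times m$ block matrix with $n\times n$ blocks $$T_{\mathrm R}^{\phi_{270^\circ}}=\begin{pmatrix} A_4 & D_4 & O & O &\dots & O & O & O\\ C_4 & A_4 & B_4 & O & \dots & O & O & O\\ O & C_4 & A_4 & B_4 &\dots & O & O & O\\ \vdots & \vdots & \vdots & \vdots &\ddots &\vdots & \vdots & \vdots\\ O & O & O & O & \dots & C_4 & A_4 & B_4\\ O & O & O & O & \dots & O & F_4 & A_4 \end{pmatrix},$$ where $A_4=A+d\,\epsilon_{n,n-1}$, $B_4=B+e\,\epsilon_{n,n-1}$, $C_4=C+c\,\epsilon_{n,n-1}$, $D_4=B+C+(c+e)\,\epsilon_{n,n-1}$ and $F_4=C+(c+e)\,\epsilon_{n,n-1}$.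
   Context: Cellular automaton. A configuration is a matrix $(x_{i,j})_{1\le i\le m,\,1\le j\le n}$ over the field $\mathbb{Z}_p$. One time step replaces every $x_{i,j}$ simultaneously by $$a x_{i-1,j-1}+b x_{i-1,j}+c x_{i-1,j+1}+d x_{i,j+1}+e x_{i+1,j+1}+f x_{i+1,j}+g x_{i+1,j-1}+h x_{i,j-1}\pmod p,$$ where values at cells outside the grid (row index $0$ or $m+1$, or column index $0$ or $n+1$) are prescribed by the boundary condition. Boundary condition $\phi_{270^\circ}$: $x_{k,0}=0$ for $0\le k\le m+1$; $x_{m+1,l}=0$ for $0\le l\le n$; $x_{0,l}=x_{2,l}$ for $1\le l\le n$; $x_{k,n+1}=x_{k,n-1}$ for $1\le k\le m$; $x_{0,n+1}=x_{2,n-1}$; $x_{m+1,n+1}=x_{m-1,n-1}$. Rule matrix. Identify a configuration with the column vector $X=(x_{11},\dots,x_{1n},\dots,x_{m1},\dots,x_{mn})^T\in\mathbb{Z}_p^{mn}$. The rule matrix is the matrix $T$ such that $X^{(t+1)}=T X^{(t)}$ for every configuration $X^{(t)}$ with successor $X^{(t+1)}$. Notation. All blocks are $n\times n$ over $\mathbb{Z}_p$. $P$ has ones on the first superdiagonal and zeros elsewhere; $Q=P^T$ has ones on the first subdiagonal; $I$ is the identity; $O$ is the zero matrix; $\epsilon_{k,l}$ is the matrix unit with a single $1$ in position $(k,l)$. $A=dP+hQ$, $B=fI+eP+gQ$, $C=bI+cP+aQ$. In the block matrix all diagonal blocks are $A_4$; the superdiagonal blocks are $B_4$ except the first one, in block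 position $(1,2)$, which is $D_4$; the subdiagonal blocks are $C_4$ except the last one, in block position $(m,m-1)$, which is $F_4$; all other blocks are $O$. *)

(* Defs.v *)
From mathcomp Require Import all_boot all_order all_algebra.
Set Implicit Arguments.
Unset Strict Implicit.
Unset Printing Implicit Defensive.
Import GRing.Theory.
Local Open Scope ring_scope.

(* Cells are numbered from 1 as usual, so the entry x_{k,l} of a configuration
   x : 'M_(m, n) is x i j with k = i.+1 and l = j.+1. An extended grid is a
   function y : nat -> nat -> R read at indices 0 <= k <= m+1, 0 <= l <= n+1;
   its values at other indices never matter. *)

Section MooreCA.
Variables (R : nzRingType) (m n : nat).

Definition extends (x : 'M[R]_(m, n)) (y : nat -> nat -> R) : Prop :=
  forall (i : 'I_m) (j : 'I_n), y i.+1 j.+1 = x i j.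

(* Null on the bottom and left, reflexive on the top and right. *)
Definition phi270 (y : nat -> nat -> R) : Prop :=
  (forall k, (k <= m + 1)%N -> y k 0%N = 0) /\
  (forall l, (l <= n)%N -> y (m + 1)%N l = 0) /\
  (forall l, (1 <= l <= n)%N -> y 0%N l = y 2%N l) /\
  (forall k, (1 <= k <= m)%N -> y k (n + 1)%N = y k (n - 1)%N) /\
  y 0%N (n + 1)%N = y 2%N (n - 1)%N /\
  y (m + 1)%N (n + 1)%N = y (m - 1)%N (n - 1)%N.

Variables a b c d e f g h : R.

(* Used only with k, l >= 1, where the truncated subtraction is exact. *)
Definition moore_rule (y : nat -> nat -> R) (k l : nat) : R :=
  a * y (k - 1)%N (l - 1)%N + b * y (k - 1)%N l + c * y (k - 1)%N (l + 1)%N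
  + d * y k (l + 1)%N + e * y (k + 1)%N (l + 1)%N + f * y (k + 1)%N l
  + g * y (k + 1)%N (l - 1)%N + h * y k (l - 1)%N.

Definition successor (bc : (nat -> nat -> R) -> Prop)
    (x x' : 'M[R]_(m, n)) : Prop :=
  exists y, [/\ extends x y, bc y &
    forall (i : 'I_m) (j : 'I_n), x' i j = moore_rule y i.+1 j.+1].

(* mxvec is row-major, so this is (x_11, ..., x_1n, ..., x_m1, ..., x_mn)^T. *)
Definition config_vec (x : 'M[R]_(m, n)) : 'cV[R]_(m * n) := (mxvec x)^T.

Definition is_rule_matrix (bc : (nat -> nat -> R) -> Prop)
    (T : 'M[R]_(m * n)) : Prop :=
  forall x x' : 'M[R]_(m, n), successor bc x x' ->
    config_vec x' = T *m config_vec x.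

End MooreCA.

Section Blocks.
Variable R : nzRingType.

Definition superdiag_mx n : 'M[R]_n := \matrix_(i, j) (j == i.+1 :> nat)%:R.

Definition subdiag_mx n : 'M[R]_n := (superdiag_mx n)^T.

(* The matrix unit epsilon_{k,l}, with k and l counted from 1. *)
Definition eps_mx n (k l : nat) : 'M[R]_n :=
  \matrix_(i, j) ((i.+1 == k) && (j.+1 == l))%:R.

Lemma sum_block_size m n : (\sum_(i < m) n = m * n)%N.
Proof. by rewrite sum_nat_const card_ord. Qed.

(* \mxblock has size \sum_(i < m) n, which is cast to m * n. *)
Definition block_matrix m n (blk : 'I_m -> 'I_m -> 'M[R]_n) : 'M[R]_(m * n) :=
  castmx (sum_block_size m n, sum_block_size m n) (\mxblock_(i, j) blk i j).

Definition tridiag_block m n (A4 B4 C4 D4 F4 : 'M[R]_n) : 'M[R]_(m * n) :=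
  block_matrix (fun i j : 'I_m =>
    if i == j then A4
    else if j == i.+1 :> nat then (if i == 0%N :> nat then D4 else B4)
    else if i == j.+1 :> nat then (if i.+1 == m then F4 else C4)
    else 0).

End Blocks.

Arguments superdiag_mx R n : clear implicits.
Arguments subdiag_mx R n : clear implicits.
Arguments eps_mx R n k l : clear implicits.
Arguments tridiag_block {R} m {n} A4 B4 C4 D4 F4.
Arguments phi270 {R} m n y.

(* Main.v *)
Require Import Defs.
From mathcomp Require Import all_boot all_order all_algebra.
Set Implicit Arguments.
Unset Strict Implicit.
Unset Printing Implicit Defensive.
Import GRing.Theory.
Local Open Scope ring_scope.

(** Write u, v, w for the weights that a rule gives to the left neighbour, to
    the cell itself and to the right neighbour of one row. If a row r satisfies
    r_0 = 0 and r_{n+1} = r_{n-1}, the weighted sums over that row, taken for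
    all columns at once, are the matrix-vector product of
      [v I + w P + u Q + w eps_{n,n-1}]
    with the visible cells of r: the missing left neighbour contributes 0,
    while the missing right neighbour of cell n is a copy of cell n-1, hence
    the extra weight w in position (n, n-1) ([stencil_cells]).

    Under the boundary condition every row 0, ..., m of the extended grid is of
    this kind, including the reflected row 0, so the three weight triples
    (h, 0, d), (g, f, e), (a, b, c) produce the blocks A4, B4, C4. Only two
    block rows need care. Row 0 is a copy of row 2, so in the first block row C4 also
    acts on row 2 and the superdiagonal block is D4 = B4 + C4. Row m+1 is null
    except for its corner, a copy of cell (m-1, n-1), so in the last block row
    the weight e survives only there, and it adds e eps_{n,n-1} to the block
    acting on row m-1: F4 = C4 + e eps_{n,n-1}. This makes the block matrix a
    rule matrix ([tridiag_rule_matrix]).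

    Conversely a rule matrix is determined by its values on the unit
    configurations, provided that each of them has a successor
    ([rule_matrix_unique]), that is, provided that the boundary condition can
    be met around every configuration ([phi270_extension]). *)

Lemma index_allpairs_pair (S T : eqType) (s : seq S) (t : seq T) x y :
    x \in s -> y \in t ->
  index (x, y) [seq (u, v) | u <- s, v <- t]
    = (index x s * size t + index y t)%N.
Proof.
move=> + y_t; elim: s => //= u s IHs; rewrite inE index_cat.
have [-> _ | neq_xu /= x_s] := eqVneq x u.
  by rewrite map_f // index_map // => ? ? [].
rewrite ifN; last by apply/mapP=> -[v _ [x_u _]]; rewrite x_u eqxx in neq_xu.
by rewrite size_map IHs // mulSn addnA.
Qed.

(** Gives the numbering of [mxvec] in closed form, so that it can be compared
    with the numbering of rows and columns in [\mxblock], which is built from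
    an unrelated enumeration. *)
Lemma mxvec_index_val m n (i : 'I_m) (j : 'I_n) :
  mxvec_index i j = (i * n + j)%N :> nat.
Proof.
rewrite /mxvec_index /= /enum_rank enum_rank_in.unlock insubdK; last first.
  by rewrite unfold_in cardT index_mem mem_enum.
by rewrite enumT unlock /= index_allpairs_pair ?mem_enum // !index_enum_ord
           size_enum_ord.
Qed.

Lemma block_matrixE (R : nzRingType) m n (blk : 'I_m -> 'I_m -> 'M[R]_n)
    i j k l :
  block_matrix blk (mxvec_index i k) (mxvec_index j l) = blk i j k l.
Proof.
have mxvec_RankE i' (k' : 'I_n) :
  cast_ord (esym (sum_block_size m n)) (mxvec_index i' k')
    = @tagnat.Rank m (fun=> n) i' k'.
  apply: val_inj; rewrite [LHS]mxvec_index_val; apply/esym.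
  rewrite [LHS]tagnat.RankEsum -(big_ord_widen _ (fun=> n)) 1?ltnW //.
  by rewrite sum_nat_const card_ord.
rewrite /block_matrix castmxE !mxvec_RankE.
by have /matrixP/(_ k l) := mxblockK blk i j; rewrite mxE.
Qed.

Lemma block_matrix_mul (R : nzRingType) m n
    (blk : 'I_m -> 'I_m -> 'M[R]_n) (x : 'M[R]_(m, n)) i j :
  (block_matrix blk *m config_vec x) (mxvec_index i j) 0
    = \sum_(i' < m) \sum_(j' < n) blk i i' j j' * x i' j'.
Proof.
rewrite mxE (reindex _ (curry_mxvec_bij _ _)) pair_bigA /=.
by apply: eq_bigr => -[i' j'] _ /=; rewrite block_matrixE mxE mxvecE.
Qed.

(** The vectors of configurations exhaust the column vectors, and if every
    configuration has a successor then both matrices must send each of them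
    to the same vector. Without extensions being available, [is_rule_matrix]
    would hold vacuously. *)
Lemma rule_matrix_unique (R : nzRingType) m n (a b c d e f g h : R) bc
    (T1 T2 : 'M[R]_(m * n)) :
    (forall x : 'M[R]_(m, n), exists y, extends x y /\ bc y) ->
    is_rule_matrix a b c d e f g h bc T1 ->
    is_rule_matrix a b c d e f g h bc T2 ->
  T1 = T2.
Proof.
move=> ext_bc rule1 rule2.
apply/trmx_inj/row_matrixP=> k; rewrite -!tr_col !colE; congr (_^T).
pose x : 'M[R]_(m, n) := vec_mx (delta_mx 0 k).
have <- : config_vec x = delta_mx k 0 by rewrite /config_vec vec_mxK trmx_delta.
have [y [ext_y bc_y]] := ext_bc x.
have succ_y : successor a b c d e f g h bc x
    (\matrix_(i, j) moore_rule a b c d e f g h y i.+1 j.+1).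
  by exists y; split=> // i j; rewrite mxE.
by rewrite -(rule1 _ _ succ_y) -(rule2 _ _ succ_y).
Qed.

Lemma phi270_extension (R : nzRingType) m n (x : 'M[R]_(m, n)) :
  (1 < m)%N -> (1 < n)%N -> exists y, extends x y /\ phi270 m n y.
Proof.
case: m n x => [|[|m]] // [|[|n]] // x _ _.
pose row k := if k == 0%N then 1%N else if k == m.+3 then m else k.-1.
pose col l := if l == n.+3 then n else l.-1.
(* [row] and [col] fold an index of the extended grid back into the grid and
   count from 0. Row m+3 = (number of rows) + 1 is folded as well, for the sake
   of the corner, the only cell of that row outside the null branch. *)
exists (fun k l => if (l == 0%N) || (k == m.+3) && (l <= n.+2)%N then 0
                   else x (inord (row k)) (inord (col l))).
split.
  move=> i j; rewrite /row /col /= !eqSS !ltn_eqF ?ltn_ord //=.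
  by rewrite !inord_val.
rewrite /phi270 /row /col !addn1 !subn1; split=> [k|]; first by [].
split=> [l le_l|]; first by rewrite eqxx le_l orbT.
split=> [l /andP[l_gt0 le_l]|]; first by [].
split=> [k /andP[k_gt0 le_k]|].
  rewrite eqxx /= ltnn andbF (gtn_eqF k_gt0).
  by rewrite (ltn_eqF (le_k : (k < m.+3)%N)) /= if_same.
by split; rewrite ?eqxx /= ?ltnn ?andbF //= !ltn_eqF.
Qed.

(** Stated for a function on [nat], so that [s] may fall outside the range:
    this is how neighbours that do not exist drop out of a sum. *)
Lemma sum_delta (V : nmodType) n (F : nat -> V) s :
  \sum_(k < n) F k *+ (k == s :> nat) = F s *+ (s < n)%N.
Proof.
have [lt_sn | le_ns] := ltnP s n.
  rewrite (bigD1 (Ordinal lt_sn)) //= eqxx big1 ?addr0 // => k.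
  by rewrite -val_eqE /= => /negPf ->.
by rewrite big1 // => k _; rewrite ltn_eqF // (leq_trans (ltn_ord k)).
Qed.

Section Stencil.
Variables (R : nzRingType) (n : nat).
Implicit Types (r : nat -> R) (j : 'I_n).

(** Index shift: [r] is numbered from 1, the entries of the vector from 0; thus
    entry [j] is the cell [r j.+1], with neighbours [r j] and [r j.+2]. *)
Definition cells r : 'cV[R]_n := \col_(k < n) r k.+1.

Lemma superdiag_cells r j :
  (superdiag_mx R n *m cells r) j 0 = r j.+2 *+ (j.+1 < n)%N.
Proof.
rewrite mxE -(sum_delta _ (fun k => r k.+1)); apply: eq_bigr => k _.
by rewrite !mxE mulr_natl.
Qed.

Lemma subdiag_cells r j :
  (subdiag_mx R n *m cells r) j 0 = r j *+ (0 < j)%N.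
Proof.
rewrite mxE; case: j => -[|j] lt_jn /=.
  by rewrite big1 // => k _; rewrite !mxE mul0r.
have := sum_delta n (fun k => r k.+1) j; rewrite (ltnW lt_jn) => <-.
apply: eq_bigr => k _.
by rewrite !mxE mulr_natl eqSS eq_sym.
Qed.

Lemma eps_cells r j : (1 < n)%N ->
  (eps_mx R n n (n - 1) *m cells r) j 0 = r j *+ (j.+1 == n).
Proof.
move=> n_gt1; have [eq_jn | neq_jn] := eqVneq; rewrite mxE; last first.
  by rewrite big1 // => k _; rewrite !mxE (negPf neq_jn) mul0r.
have def_n1 : (n - 1)%N = n.-2.+1.
  by case: (n) n_gt1 => [|[|?]] // _; rewrite subn1.
have def_j : j = n.-2.+1 :> nat by rewrite -def_n1 subn1 -[LHS]/j.+1.-1 eq_jn.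
have lt_n2 : (n.-2 < n)%N by rewrite -def_j ltnW.
have := sum_delta n (fun k => r k.+1) n.-2; rewrite lt_n2 def_j => <-.
apply: eq_bigr => k _.
rewrite !mxE eq_jn eqxx mulr_natl; congr (_ *+ (_ : bool)).
by rewrite def_n1 eqSS.
Qed.

Definition stencil_mx (u v w : R) : 'M[R]_n :=
  v *: 1%:M + w *: superdiag_mx R n + u *: subdiag_mx R n
  + w *: eps_mx R n n (n - 1).

(** At most one of P and eps_{n,n-1} contributes in a given row: P supplies the
    right neighbour of the cells 1, ..., n-1, and eps_{n,n-1} that of cell n,
    which by reflection is cell n-1. On the left nothing has to be added, since
    the missing neighbour is null. *)
Lemma stencil_cells u v w r j :
    (1 < n)%N -> r 0%N = 0 -> r (n + 1)%N = r (n - 1)%N ->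
  (stencil_mx u v w *m cells r) j 0 = u * r j + v * r j.+1 + w * r j.+2.
Proof.
move=> n_gt1 r0 r_refl.
rewrite !mulmxDl -!scalemxAl mul1mx.
have entryD (M N : 'cV[R]_n) : (M + N) j 0 = M j 0 + N j 0 by rewrite mxE.
have entryZ z (M : 'cV[R]_n) : (z *: M) j 0 = z * M j 0 by rewrite mxE.
rewrite !entryD !entryZ superdiag_cells subdiag_cells eps_cells //.
rewrite [LHS](ACl ((3*1)*(2*4))) /= -mulrDr [cells r j 0]mxE.
have -> : r j *+ (0 < j)%N = r j by case: (nat_of_ord j) => [|k]; rewrite ?r0.
congr (_ + _ * _); have [eq_jn | neq_jn] := eqVneq j.+1 n.
  rewrite eq_jn ltnn add0r -addn1 r_refl subn1.
  by congr (r _); apply: (congr1 predn eq_jn).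
by rewrite ltn_neqAle neq_jn ltn_ord addr0.
Qed.

End Stencil.

(** The rows are read from an extended grid [y] rather than from [x], so that
    the neighbouring rows [y i] and [y i.+2] make sense for every [i]; a block
    that is missing in the first or last block row shows only as a truth-value
    multiplicity. *)
Lemma tridiag_block_mul (R : nzRingType) m n (A4 B4 C4 D4 F4 : 'M[R]_n)
    (x : 'M[R]_(m, n)) y (i : 'I_m) j :
    extends x y ->
  (tridiag_block m A4 B4 C4 D4 F4 *m config_vec x) (mxvec_index i j) 0
  = (A4 *m cells n (y i.+1)) j 0
    + ((if i == 0%N :> nat then D4 else B4) *m cells n (y i.+2)) j 0
        *+ (i.+1 < m)%N
    + ((if i.+1 == m then F4 else C4) *m cells n (y i)) j 0 *+ (0 < i)%N.
Proof.
move=> ext_y; rewrite block_matrix_mul.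
pose M B k : R := (B *m cells n (y k.+1)) j 0.
have M_E (B : 'M[R]_n) (k : 'I_m) : \sum_(l < n) B j l * x k l = M B k.
  by rewrite /M mxE; apply: eq_bigr => l _; rewrite mxE ext_y.
under eq_bigr do rewrite M_E.
set B1 := if _ then D4 else B4; set C1 := if _ then F4 else C4.
have -> : (C1 *m cells n (y i)) j 0 *+ (0 < i)%N
    = \sum_(k < m) M C1 k *+ (i == k.+1 :> nat).
  case: i @B1 @C1 => -[|i] lt_im B1 C1 /=; first by rewrite big1.
  have := sum_delta m (M C1) i; rewrite (ltnW lt_im) => <-.
  by apply: eq_bigr => k _; rewrite eqSS eq_sym.
have -> : (A4 *m cells n (y i.+1)) j 0 = M A4 i *+ (i < m)%N.
  by rewrite ltn_ord.
rewrite -[(B1 *m _) j 0]/(M B1 i.+1) -!sum_delta -!big_split /=.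
apply: eq_bigr => k _; have [-> | neq_ik] := eqVneq i k.
  by rewrite eqxx !ltn_eqF // !addr0.
rewrite -val_eqE /= in neq_ik.
rewrite [k == i :> nat]eq_sym (negPf neq_ik) add0r.
have [-> | _] := eqVneq (k : nat) i.+1; first by rewrite ltn_eqF ?addr0.
by case: eqP => _; rewrite ?add0r ?addr0 // /M mul0mx mxE.
Qed.

(** Each middle block row is the sum of three stencils. In the first one the
    block above is missing, and what it should have contributed, C4 on row 0,
    is C4 on row 2; in the last one the block below is missing, and what it
    should have contributed is e times the corner cell in column n. *)
Lemma tridiag_rule_matrix (R : nzRingType) m n (a b c d e f g h : R) :
    (1 < m)%N -> (1 < n)%N ->
  is_rule_matrix a b c d e f g h (phi270 m n)
    (tridiag_block m (stencil_mx n h 0 d) (stencil_mx n g f e)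
       (stencil_mx n a b c) (stencil_mx n g f e + stencil_mx n a b c)
       (stencil_mx n a b c + e *: eps_mx R n n (n - 1))).
Proof.
move=> m_gt1 n_gt1 x x' [y [ext_y bc_y step]].
have [y_left [y_bot [y_top [y_right [y_tr y_br]]]]] := bc_y.
have row_refl k : (k <= m)%N -> y k 0%N = 0 /\ y k (n + 1)%N = y k (n - 1)%N.
  move=> le_km; split; first by rewrite y_left // (leq_trans le_km) ?leq_addr.
  case: k le_km => [_ | k le_km]; last by rewrite y_right.
  by rewrite y_tr y_top // subn_gt0 n_gt1 leq_subr.
have stencilE k (i : 'I_n) u v w : (k <= m)%N ->
    (stencil_mx n u v w *m cells n (y k)) i 0
      = u * y k i + v * y k i.+1 + w * y k i.+2.
  by move=> /row_refl[? ?]; apply: stencil_cells.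
apply/colP=> s; case/mxvec_indexP: s => i j; apply/esym.
rewrite (tridiag_block_mul _ _ _ _ _ _ _ ext_y) stencilE //.
rewrite [RHS]mxE mxvecE step /moore_rule ![in RHS]subn1 ![in RHS]addn1 /=.
rewrite mul0r addr0.
have entryD (M N : 'cV[R]_n) : (M + N) j 0 = M j 0 + N j 0 by rewrite mxE.
have entryZ z (M : 'cV[R]_n) : (z *: M) j 0 = z * M j 0 by rewrite mxE.
have [eq_im | neq_im] := eqVneq i.+1 m.
  have i_gt0 : (0 < i)%N by rewrite -ltnS eq_im.
  rewrite i_gt0 [(_ < m)%N]ltn_neqAle eq_im eqxx mulr0n addr0.
  rewrite mulmxDl -scalemxAl entryD entryZ.
  rewrite stencilE 1?ltnW // eps_cells //.
  have -> : y m.+1 j = 0 by rewrite -addn1 y_bot // ltnW.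
  have -> : y m.+1 j.+1 = 0 by rewrite -addn1 y_bot.
  (* Of row m+1 only the corner is nonzero; [y i j] is then cell (m-1, n-1). *)
  have -> : y m.+1 j.+2 = y i j *+ (j.+1 == n).
    have [eq_jn | neq_jn] := eqVneq; rewrite -addn1; last first.
      by rewrite y_bot // ltn_neqAle neq_jn ltn_ord.
    rewrite eq_jn -[n.+1]addn1 y_br !subn1.
    have im1 := congr1 predn eq_im; have jn1 := congr1 predn eq_jn.
    by rewrite /= in im1 jn1; congr (y _ _).
  by rewrite !mulr0 !addr0 [RHS](ACl (6*4*(1*2*3*5))).
have lt_im : (i.+1 < m)%N by rewrite ltn_neqAle neq_im ltn_ord.
rewrite lt_im mulr1n.
have [i0 | i_gt0] := posnP i; last first.
  by rewrite mulr1n !stencilE ?(ltnW (ltn_ord i)) //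
             [RHS](ACl ((8*4)*(7*6*5)*(1*2*3))).
(* The reflection extends to both ends of row 0: both left ends are null, and
   the right corner agrees with cell (2, n+1) since each copies (2, n-1). *)
have y_topE l : (l <= n.+1)%N -> y 0%N l = y 2%N l.
  case: l => [_ | l]; first by rewrite !y_left // addn1 ltnW.
  rewrite ltnS leq_eqVlt => /orP[/eqP-> | lt_ln]; last by rewrite y_top.
  by rewrite -addn1 y_tr y_right // m_gt1.
rewrite i0 mulr0n addr0 mulmxDl entryD !stencilE //.
rewrite !y_topE ?ltnS ?(leqW (ltnW (ltn_ord j))) ?(ltnW (ltn_ord j)) //.
by rewrite [RHS](ACl ((8*4)*((7*6*5)*(1*2*3)))).
Qed.

Theorem theorem3p5 (p m n : nat) (p_prime : prime p)
    (m_ge2 : (2 <= m)%N) (n_ge2 : (2 <= n)%N) (a b c d e f g h : 'F_p) :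
  let P := superdiag_mx 'F_p n in
  let Q := subdiag_mx 'F_p n in
  let I := 1%:M : 'M['F_p]_n in
  let eps := eps_mx 'F_p n n (n - 1)%N in
  let A := d *: P + h *: Q in
  let B := f *: I + e *: P + g *: Q in
  let C := b *: I + c *: P + a *: Q in
  let A4 := A + d *: eps in
  let B4 := B + e *: eps in
  let C4 := C + c *: eps in
  let D4 := B + C + (c + e) *: eps in
  let F4 := C + (c + e) *: eps in
  forall T : 'M['F_p]_(m * n),
    is_rule_matrix a b c d e f g h (phi270 m n) T <->
    T = tridiag_block m A4 B4 C4 D4 F4.
Proof.
move=> P Q I eps A B C A4 B4 C4 D4 F4 T.
have -> : A4 = stencil_mx n h 0 d by rewrite /stencil_mx scale0r add0r.
have -> : D4 = stencil_mx n g f e + stencil_mx n a b c.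
  by rewrite /D4 scalerDl [c *: _ + _]addrC addrACA.
have -> : F4 = stencil_mx n a b c + e *: eps by rewrite /F4 scalerDl addrA.
have rule := @tridiag_rule_matrix _ m n a b c d e f g h m_ge2 n_ge2.
split=> [ruleT | -> //].
by apply: rule_matrix_unique ruleT rule => x; apply: phi270_extension.
Qed.
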